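(* There exist absolute constants $c,C>0$ such that for every four cycle-free Boolean matrix $M$ of degeneracy $d$, we have $c\sqrt{d}\leq \gamma_2(M)\leq C\sqrt{d}$, i.e. $\gamma_2(M)=\Theta(\sqrt d)$.
   Context: A Boolean matrix has entries in $\{0,1\}$; a submatrix is obtained by selecting any subset of rows and any subset of columns. A Boolean matrix is four cycle-free if it contains no $2\times 2$ all-ones submatrix. The degeneracy of a Boolean matrix $M$ is the smallest integer $d$ such that every (nonempty) submatrix of $M$ has a row or a column with at most $d$ one-entries. For a real matrix $M$, $\gamma_2(M)=\min_{U,V:\,M=UV}\|U\|_{\mathrm{row}}\|V\|_{\mathrm{col}}$, where $\|U\|_{\mathrm{row}}$ is the maximum Euclidean norm of a row of $U$ and $\|V\|_{\mathrm{col}}$ is the maximum Euclidean norm of a column of $V$. *)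

(* Defs.v *)
From HB Require Import structures.
From mathcomp Require Import all_boot all_order all_algebra.
From mathcomp Require Import all_classical all_reals all_analysis.

Set Implicit Arguments.
Unset Strict Implicit.
Unset Printing Implicit Defensive.

Import Order.TTheory GRing.Theory Num.Theory.
Import numFieldNormedType.Exports.

Local Open Scope classical_set_scope.
Local Open Scope ring_scope.

(* A submatrix is given by its set A of rows and its set B of columns. *)
Definition four_cycle_free m n (M : 'M[bool]_(m, n)) : Prop :=
  forall (A : {set 'I_m}) (B : {set 'I_n}), #|A| = 2%N -> #|B| = 2%N ->
    ~ (forall i j, i \in A -> j \in B -> M i j).

Definition degenerate m n (M : 'M[bool]_(m, n)) (d : nat) : bool :=
  [forall A : {set 'I_m}, forall B : {set 'I_n},
    (A != finset.set0) && (B != finset.set0) ==>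
    [exists i in A, (#|[set j in B | M i j]%SET| <= d)%N] ||
    [exists j in B, (#|[set i in A | M i j]%SET| <= d)%N]].

Lemma degenerate_ex m n (M : 'M[bool]_(m, n)) : exists d, degenerate M d.
Proof.
exists n; apply/forallP => A; apply/forallP => B; apply/implyP => /andP[A0 _].
have /set0Pn[i iA] := A0.
apply/orP; left; apply/existsP; exists i; rewrite iA /=.
by rewrite (leq_trans (max_card _)) ?card_ord.
Qed.

Definition degeneracy m n (M : 'M[bool]_(m, n)) : nat :=
  ex_minn (degenerate_ex M).

Section Gamma2.
Context {R : realType}.

Definition bool_mx m n (M : 'M[bool]_(m, n)) : 'M[R]_(m, n) :=
  map_mx (fun b : bool => b%:R) M.

Definition row_norm m n (U : 'M[R]_(m, n)) : R :=
  \big[Num.max/0]_(i < m) Num.sqrt (\sum_(j < n) U i j ^+ 2).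

Definition col_norm m n (V : 'M[R]_(m, n)) : R :=
  \big[Num.max/0]_(j < n) Num.sqrt (\sum_(i < m) V i j ^+ 2).

Definition factor_norms m n (M : 'M[R]_(m, n)) : set R :=
  [set g | exists (k : nat) (U : 'M[R]_(m, k)) (V : 'M[R]_(k, n)),
     M = U *m V /\ g = row_norm U * col_norm V].

(* The infimum is a minimum: see gamma2_in and gamma2_le below. *)
Definition gamma2 m n (M : 'M[R]_(m, n)) : R := inf (factor_norms M).

Lemma row_norm_ge0 m n (U : 'M[R]_(m, n)) : 0 <= row_norm U.
Proof. by rewrite /row_norm; elim/big_ind: _ => // x y; rewrite le_max => ->. Qed.

Lemma row_norm_le m n (U : 'M[R]_(m, n)) (b : R) : 0 <= b ->
  (row_norm U <= b) <-> (forall i, (U *m U^T) i i <= b ^+ 2).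
Proof.
move=> b0.
have E i : (U *m U^T) i i = \sum_(j < n) U i j ^+ 2.
  by rewrite mxE; apply: eq_bigr => j _; rewrite !mxE expr2.
have S0 i : 0 <= \sum_(j < n) U i j ^+ 2.
  by apply: sumr_ge0 => j _; exact: sqr_ge0.
have H i : (Num.sqrt (\sum_(j < n) U i j ^+ 2) <= b) = ((U *m U^T) i i <= b ^+ 2).
  by rewrite E -(ler_sqrt _ (exprn_ge0 2 b0)) sqrtr_sqr ger0_norm.
split => [h i | h].
  by rewrite -H; apply: le_trans h; rewrite /row_norm; apply: le_bigmax_cond.
by apply: bigmax_le => // i _; rewrite H.
Qed.

Lemma col_normE m n (V : 'M[R]_(m, n)) : col_norm V = row_norm V^T.
Proof.
by apply: eq_bigr => j _; congr Num.sqrt; apply: eq_bigr => i _; rewrite mxE.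
Qed.

Lemma gram_square N k (W : 'M[R]_(N, k)) :
  exists L : 'M[R]_N, L *m L^T = W *m W^T.
Proof.
elim: N W => [|N IH] W; first by exists 0; apply/matrixP => -[].
move: W; rewrite -[N.+1]/(1 + N)%N => W.
rewrite -(vsubmxK W); move: (usubmx W) (dsubmx W) => w X {W}.
pose s := (w *m w^T) 0 0; pose a := Num.sqrt s.
have ww : w *m w^T = s%:M by rewrite [LHS]mx11_scalar.
have s0 : 0 <= s.
  by rewrite /s mxE; apply: sumr_ge0 => j _; rewrite [w^T _ _]mxE -expr2 sqr_ge0.
have aa : a * a = s by rewrite -expr2 sqr_sqrtr.
have w0 : s = 0 -> w = 0.
  move=> s_0; apply/matrixP => i j; rewrite ord1 [RHS]mxE.
  have P l : true -> 0 <= w 0 l * w^T l 0.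
    by move=> _; rewrite [w^T _ _]mxE -expr2 sqr_ge0.
  have := psumr_eq0P (fun l => P l); move: s_0; rewrite /s mxE => s_0.
  by move/(_ s_0 j isT)/eqP; rewrite [w^T _ _]mxE mulf_eq0 orbb => /eqP.
pose b := a^-1 *: (X *m w^T).
have [L1 HL1] := IH (X - a^-1 *: (b *m w)).
have ab : a *: b = X *m w^T.
  rewrite /b scalerA; have [a_0|a_0] := eqVneq a 0; last by rewrite divff // scale1r.
  by rewrite a_0 mul0r scale0r w0 ?trmx0 ?mulmx0 // -aa a_0 mul0r.
have bb : b *m b^T = a^-1 *: (b *m (w *m X^T)).
  by rewrite {2}/b linearZ /= trmx_mul trmxK -scalemxAr.
have bb2 : b *m b^T = a^-1 *: (X *m w^T *m b^T).
  by rewrite {1}/b -!scalemxAl.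
have wb : a^-1 * a^-1 *: (b *m (w *m w^T) *m b^T) = b *m b^T.
  rewrite ww mul_mx_scalar -scalemxAl scalerA -aa.
  have [a_0|a_0] := eqVneq a 0.
    by rewrite /b a_0 invr0 scale0r mul0mx scaler0.
  by rewrite -mulrA mulKf // mulVf // scale1r.
exists (block_mx a%:M 0 b L1).
rewrite tr_block_mx mulmx_block tr_col_mx mul_col_row trmx0.
rewrite !mul0mx !mulmx0 !addr0 tr_scalar_mx -scalar_mxM aa -ww HL1.
congr (block_mx _ _ _ _).
- by rewrite mul_scalar_mx -linearZ /= ab trmx_mul trmxK.
- by rewrite mul_mx_scalar ab.
rewrite linearB /= linearZ /= trmx_mul mulmxBl !mulmxBr.
have -> : b *m (a^-1 *: (w^T^T *m X^T)) = b *m b^T.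
  by rewrite bb trmxK -scalemxAr.
have -> : X *m (a^-1 *: (b *m w))^T = b *m b^T.
  by rewrite bb2 linearZ /= trmx_mul -scalemxAr mulmxA.
have -> : a^-1 *: (b *m w) *m X^T = b *m b^T.
  by rewrite bb -scalemxAl mulmxA.
have -> : a^-1 *: (b *m w) *m (a^-1 *: (b *m w))^T = b *m b^T.
  by rewrite -wb linearZ /= trmx_mul -scalemxAl -scalemxAr scalerA !mulmxA.
by rewrite subrr subr0 addrC subrK.
Qed.

Lemma row_normZ m n (t : R) (U : 'M[R]_(m, n)) : 0 <= t ->
  row_norm (t *: U) <= t * row_norm U.
Proof.
move=> t0; have r0 := row_norm_ge0 U.
apply/row_norm_le; first exact: mulr_ge0.
move=> i; rewrite linearZ /= -scalemxAl -scalemxAr scalerA mxE -expr2 exprMn.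
by apply: ler_wpM2l; [exact: exprn_ge0 | move: i; exact/(row_norm_le U r0)].
Qed.

Lemma row_norm_entry m n (U : 'M[R]_(m, n)) i j : `|U i j| <= row_norm U.
Proof.
apply: (@le_trans _ _ (Num.sqrt (\sum_l U i l ^+ 2))).
  rewrite -sqrtr_sqr ler_wsqrtr // (bigD1 j) //= lerDl.
  by apply: sumr_ge0 => l _; exact: sqr_ge0.
by rewrite /row_norm; apply: (le_bigmax_cond _ (fun i => Num.sqrt (\sum_l U i l ^+ 2))).
Qed.

Lemma row_norm_eq0 m n (U : 'M[R]_(m, n)) : row_norm U = 0 -> U = 0.
Proof.
move=> U0; apply/matrixP => i j; rewrite [RHS]mxE; apply/eqP.
by rewrite -normr_le0 -U0 row_norm_entry.
Qed.

Lemma row_norm0 m n : row_norm (0 : 'M[R]_(m, n)) = 0.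
Proof.
apply/eqP; rewrite eq_le row_norm_ge0 andbT; apply/row_norm_le => // i.
by rewrite mul0mx mxE expr0n.
Qed.

Lemma factor_norms_balanced m n k (U : 'M[R]_(m, k)) (V : 'M[R]_(k, n)) :
  exists2 W : 'M[R]_(m + n),
    usubmx W *m (dsubmx W)^T = U *m V &
    row_norm W ^+ 2 <= row_norm U * col_norm V.
Proof.
rewrite col_normE; set r := row_norm U; set c := row_norm V^T.
have r0 : 0 <= r := row_norm_ge0 U.
have c0 : 0 <= c := row_norm_ge0 V^T.
have [rc0|rc0] := eqVneq (r * c) 0.
  exists 0; last by rewrite row_norm0 rc0 expr0n.
  move/eqP: rc0; rewrite mulf_eq0 linear0 mul0mx => /orP[|] /eqP /row_norm_eq0.
    by move=> ->; rewrite mul0mx.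
  by move=> /(congr1 trmx); rewrite trmxK trmx0 => ->; rewrite mulmx0.
have [rp cp] : 0 < r /\ 0 < c.
  by move: rc0; rewrite mulf_eq0 negb_or !lt_def r0 c0 !andbT => /andP.
pose t := Num.sqrt (c / r).
have tp : 0 < t by rewrite sqrtr_gt0 divr_gt0.
have t2 : t ^+ 2 = c / r by rewrite sqr_sqrtr // divr_ge0.
pose X := col_mx (t *: U) (t^-1 *: V^T).
have [W HW] := gram_square X.
exists W.
  have := congr1 ursubmx HW.
  rewrite -{1 2}(vsubmxK W) tr_col_mx mul_col_row block_mxKur => ->.
  rewrite /X tr_col_mx mul_col_row block_mxKur linearZ /= trmxK.
  by rewrite -scalemxAl -scalemxAr scalerA divff ?scale1r // gt_eqF.
have s0 : 0 <= Num.sqrt (r * c) := sqrtr_ge0 _.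
rewrite -[leRHS]sqr_sqrtr ?mulr_ge0 //.
rewrite ler_sqr ?nnegrE ?row_norm_ge0 //; apply/row_norm_le => // i.
rewrite HW sqr_sqrtr ?mulr_ge0 // /X tr_col_mx mul_col_row.
have hU := (row_norm_le U r0).1 (lexx _).
have hV := (row_norm_le V^T c0).1 (lexx _).
case: (split_ordP i) => j ->; rewrite ?block_mxEul ?block_mxEdr linearZ /=.
  rewrite -scalemxAl -scalemxAr scalerA mxE -expr2 t2.
  apply: le_trans (ler_wpM2l _ (hU j)) _; first by rewrite divr_ge0.
  by rewrite expr2 mulrA divfK ?gt_eqF // mulrC.
rewrite -scalemxAl -scalemxAr scalerA mxE -expr2 exprVn t2 invf_div.
apply: le_trans (ler_wpM2l _ (hV j)) _; first by rewrite divr_ge0.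
by rewrite expr2 mulrA divfK ?gt_eqF.
Qed.

Lemma factor_norms_min m n (M : 'M[R]_(m, n)) :
  exists2 g, factor_norms M g & lbound (factor_norms M) g.
Proof.
pose N := (m + n)%N.
pose f (x : 'rV[R]_(N * N)) : R := row_norm (vec_mx x : 'M[R]_N).
have fc : continuous f.
  rewrite /f /row_norm; apply: continuous_big => [|i _].
    exact: max_continuous.
  move=> x; apply: continuous_comp; last exact: sqrt_continuous.
  move: x; apply: continuous_big => [|j _]; first exact: add_continuous.
  move=> x; under eq_fun do rewrite mxE.
  by apply: continuousM; exact: coord_continuous.
pose K0 := [set x : 'rV[R]_(N * N) |
  usubmx (vec_mx x : 'M[R]_N) *m (dsubmx (vec_mx x : 'M[R]_N))^T = M].
have K0c : closed K0.
  have -> : K0 = \bigcap_(p in [set: 'I_m * 'I_n]) [set x |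
      \sum_(l < N) x 0 (mxvec_index (lshift n p.1) l) *
                   x 0 (mxvec_index (rshift m p.2) l) = M p.1 p.2].
    apply/seteqP; split => x /=.
      move=> xM [i j] _ /=; rewrite -xM mxE; apply: eq_bigr => l _.
      by rewrite !mxE.
    move=> xM; apply/matrixP => i j; rewrite -(xM (i, j) I) mxE.
    by apply: eq_bigr => l _; rewrite !mxE.
  apply: closed_bigI => p _; apply: (closed_comp _ (@closed_eq _ _)) => x _.
  move: x; apply: continuous_big => [|j _]; first exact: add_continuous.
  by move=> x; apply: continuousM; exact: coord_continuous.
have [W1 W1M _] := factor_norms_balanced M 1%:M.
rewrite mulmx1 in W1M.
pose B := row_norm W1.
pose K := [set x : 'rV[R]_(N * N) | forall i, `[- B, B]%classic (x 0 i)] `&` K0.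
have Kc : compact K.
  apply: compact_closedI => //.
  by apply: (@rV_compact _ _ (fun=> `[- B, B]%classic)) => i; exact: segment_compact.
have inK (W : 'M[R]_N) : usubmx W *m (dsubmx W)^T = M -> row_norm W <= B ->
    K (mxvec W).
  move=> WM WB; split; last by rewrite /K0 /= mxvecK.
  move=> l /=; case/mxvec_indexP: l => i j; rewrite mxvecE in_itv /= -ler_norml.
  exact: le_trans (row_norm_entry _ _ _) WB.
have K1 : K !=set0 by exists (mxvec W1); exact: inK.
have [x /set_mem [_ xK0] xmin] :=
  compact_EVT_min K1 Kc (continuous_subspaceT fc).
have f0 : 0 <= f x := row_norm_ge0 _.
have lb : lbound (factor_norms M) (f x ^+ 2).
  move=> g [k [U [V [MUV ->]]]].
  have [W WUV Wle] := factor_norms_balanced U V.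
  apply: le_trans Wle; rewrite ler_sqr ?nnegrE ?row_norm_ge0 //.
  have fle (X : 'M[R]_N) : usubmx X *m (dsubmx X)^T = M -> row_norm X <= B ->
      f x <= row_norm X.
    by move=> XM XB; rewrite -[X]mxvecK; apply: xmin; rewrite inE; exact: inK.
  have [WB|/ltW BW] := leP (row_norm W) B; first by apply: fle; rewrite ?WUV.
  by apply: le_trans BW; exact: fle.
exists (f x ^+ 2) => //.
set X : 'M[R]_N := vec_mx x in f0 xK0 *.
exists N, (usubmx X), (dsubmx X)^T; split=> //.
apply/eqP; rewrite eq_le; apply/andP; split.
  by apply: lb; exists N, (usubmx X), (dsubmx X)^T.
have h := (row_norm_le X f0).1 (lexx _).
have XX : X *m X^T = col_mx (usubmx X) (dsubmx X) *m (col_mx (usubmx X) (dsubmx X))^T.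
  by rewrite vsubmxK.
rewrite tr_col_mx mul_col_row in XX.
rewrite expr2 col_normE trmxK; apply: ler_pM; rewrite ?row_norm_ge0 //.
  by apply/row_norm_le => // i; have := h (lshift n i); rewrite XX block_mxEul.
by apply/row_norm_le => // i; have := h (rshift m i); rewrite XX block_mxEdr.
Qed.

Lemma gamma2_le m n (M : 'M[R]_(m, n)) : lbound (factor_norms M) (gamma2 M).
Proof.
have [g _ glb] := factor_norms_min M.
by apply: ge_inf; exists g.
Qed.

Lemma gamma2_in m n (M : 'M[R]_(m, n)) : factor_norms M (gamma2 M).
Proof.
have [g gM glb] := factor_norms_min M.
suff -> : gamma2 M = g by [].
apply/eqP; rewrite eq_le gamma2_le //=.
by apply: lb_le_inf => //; exists g.
Qed.

End Gamma2.

(* Main.v *)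
(* Upper bound: deleting one at a time rows and columns with at most d ones
   writes M = M1 + M2, where every row of M1 and every column of M2 has at most
   d ones; then M = [M1, t I] [I; M2 / t] with t = sqrt d.

   Lower bound: pass to a submatrix of minimum degree at least d, say m x n with
   n <= m. Put p_i = 1 / deg i, s_j = sum_(i ~ j) p_i, and let X have entries
   sqrt (p_i / s_j) M_ij. The columns of X are unit vectors, and four-cycle
   freeness makes their inner products so small that G = X^T X satisfies
   sum_j s_j (G^2)_jj <= m + n. As sum_j s_j = m, the s-weighted spectral
   mass of G is not concentrated at 0, so the truncated polar part T of X pairs with M, under
   the weights sqrt (p_i) and sqrt (s_j), to at least m / 2. As T is a
   contraction, sum_i p_i <= m / d and sum_j s_j = m, the pairing is at most
   gamma2 M * m / sqrt d. *)

Require Import Defs.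
From mathcomp Require Import all_boot all_order all_algebra.
From mathcomp Require Import all_classical all_reals all_analysis.
From mathcomp Require Import ring lra.

Import Order.TTheory GRing.Theory Num.Theory.
Local Open Scope ring_scope.

(** * Gram matrices and the truncated polar factor *)

Lemma gram_diag_ge0 {R : realType} {m n} (W : 'M[R]_(m, n)) j :
  0 <= (W^T *m W) j j.
Proof. by rewrite mxE sumr_ge0 // => i _; rewrite mxE -expr2 sqr_ge0. Qed.

Lemma gram_mxtrace_ge0 {R : realType} {m n} (W : 'M[R]_(m, n)) :
  0 <= \tr (W^T *m W).
Proof. by apply: sumr_ge0 => j _; exact: gram_diag_ge0. Qed.

Lemma gram_mxtraceE {R : realType} {m n} (W : 'M[R]_(m, n)) :
  \tr (W^T *m W) = \sum_i (W *m W^T) i i.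
Proof. by rewrite mxtrace_mulC. Qed.

Lemma gram_eq0 {R : realType} {n} (v : 'rV[R]_n) : (v *m v^T) 0 0 = 0 -> v = 0.
Proof.
rewrite mxE => v0; apply/matrixP => i j; rewrite ord1 [RHS]mxE.
have P l : true -> 0 <= v 0 l * v^T l 0.
  by move=> _; rewrite mxE -expr2 sqr_ge0.
have /eqP : v 0 j * v^T j 0 = 0 by exact: (psumr_eq0P P v0).
by rewrite mxE mulf_eq0 orbb => /eqP.
Qed.

(** A left kernel vector [v] satisfies [|v|^2 + |X v^T|^2 = 0], hence vanishes. *)
Lemma add1_gram_unit {R : realType} {m n} (X : 'M[R]_(m, n)) :
  1%:M + X^T *m X \in unitmx.
Proof.
rewrite -row_free_unit; apply: inj_row_free => v.
rewrite mulmxDr mulmx1 => v0; apply: gram_eq0.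
have : (v + v *m (X^T *m X)) *m v^T = v *m v^T + (X *m v^T)^T *m (X *m v^T).
  by rewrite mulmxDl trmx_mul trmxK !mulmxA.
rewrite v0 mul0mx => /matrixP/(_ 0 0)/esym/eqP.
rewrite [X in X == _]mxE [X in _ == X]mxE paddr_eq0 ?gram_diag_ge0 //; first by case/andP => /eqP.
by rewrite -{1}(trmxK v) gram_diag_ge0.
Qed.

(* T = 2 X (1 + X^T X)^-1 is a rational substitute for the polar part of X:
   2 t / (1 + t ^ 2) <= 1 bounds its singular values, and
   2 (2 t ^ 2 / (1 + t ^ 2)) >= 3 t ^ 2 - t ^ 4. *)
Lemma truncated_polar {R : realType} {m n} (X : 'M[R]_(m, n)) :
  exists2 T : 'M[R]_(m, n),
    exists Y : 'M[R]_n, T^T *m T + Y^T *m Y = 1%:M &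
    forall j, 3 * (X^T *m X) j j - (X^T *m X *m (X^T *m X)) j j
      <= 2 * (X^T *m T) j j.
Proof.
have Au := add1_gram_unit X.
set G := X^T *m X in Au *; pose K := invmx (1%:M + G).
have GT : G^T = G by rewrite trmx_mul trmxK.
have KT : K^T = K by rewrite trmx_inv linearD /= trmx1 GT.
have GK : G *m K = 1%:M - K.
  by rewrite -(mulmxV Au) mulmxDl mul1mx addrC addKr.
have KG : K *m G = 1%:M - K.
  by rewrite -(mulVmx Au) mulmxDr mulmx1 addrC addKr.
have XXK : X^T *m (X *m K) = 1%:M - K by rewrite mulmxA.
exists (2 *: (X *m K)).
  (* [T^T T = 4 (K - K^2)], whose complement to the identity is the square of [1 - 2 K]. *)
  exists (1%:M - 2 *: K).
  have -> : (1%:M - 2 *: K)^T = 1%:M - 2 *: K.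
    by rewrite linearB /= linearZ /= trmx1 KT.
  have -> : (2 *: (X *m K))^T = 2 *: (K *m X^T).
    by rewrite linearZ /= trmx_mul KT.
  rewrite -scalemxAl -scalemxAr -mulmxA XXK.
  rewrite !(mulmxBl, mulmxBr, mulmx1, mul1mx) -!scalemxAl -!scalemxAr.
  by apply/matrixP => i j; move: (K *m K) => KK; rewrite !mxE; ring.
move=> j; rewrite -scalemxAr XXK -subr_ge0.
pose D := 1%:M - G; have DT : D^T = D by rewrite linearB /= trmx1 GT.
(* The slack is [D (1 - K) D], in scalar terms [g (1 - g)^2 / (1 + g)]. Splitting
   [1 - K = K (1 - K) + (1 - K)^2] makes each summand a Gram matrix. *)
have -> : 2 * (2 *: (1%:M - K)) j j - (3 * G j j - (G *m G) j j) =
    ((X *m K *m D)^T *m (X *m K *m D)) j j +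
    ((D - K *m D)^T *m (D - K *m D)) j j.
  have addE (A B : 'M[R]_n) : A j j + B j j = (A + B) j j by rewrite [RHS]mxE.
  rewrite addE.
  have -> : (X *m K *m D)^T *m (X *m K *m D) = D *m (K *m (1%:M - K)) *m D.
    by rewrite !trmx_mul KT DT -XXK !mulmxA.
  have -> : (D - K *m D)^T *m (D - K *m D) =
      D *m ((1%:M - K) *m (1%:M - K)) *m D.
    have -> : D - K *m D = (1%:M - K) *m D by rewrite mulmxBl mul1mx.
    have -> : ((1%:M - K) *m D)^T = D *m (1%:M - K).
      by rewrite trmx_mul DT [in LHS]linearB /= trmx1 KT.
    by rewrite !mulmxA.
  rewrite -mulmxDl -mulmxDr -mulmxDl (addrC K) subrK mul1mx.
  rewrite /D !(mulmxBl, mulmxBr, mulmx1, mul1mx) GK KG.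
  rewrite !(mulmxBl, mulmxBr, mulmx1, mul1mx) KG.
  by move: (G *m G) => GG; rewrite !mxE; ring.
by rewrite addr_ge0 ?gram_diag_ge0.
Qed.

(** [Y] certifies that [T] is a contraction: the two sides differ by [|a - T b|^2 + |Y b|^2] in the
    Frobenius norm. *)
Lemma contraction_form_le {R : realType} {m n k l} (T : 'M[R]_(m, n))
    (Y : 'M[R]_(k, n)) (a : 'M[R]_(m, l)) (b : 'M[R]_(n, l)) :
  T^T *m T + Y^T *m Y = 1%:M ->
  2 * \tr (a^T *m T *m b) <= \tr (a^T *m a) + \tr (b^T *m b).
Proof.
move=> TY; have := gram_mxtrace_ge0 (a - T *m b).
have := gram_mxtrace_ge0 (Y *m b).
have -> : (a - T *m b)^T = a^T - b^T *m T^T.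
  by rewrite [LHS]linearB /= trmx_mul.
rewrite trmx_mul !(mulmxBl, mulmxBr) !linearB /=.
have -> : \tr (b^T *m T^T *m a) = \tr (a^T *m T *m b).
  by rewrite -mxtrace_tr !trmx_mul !trmxK mulmxA.
have -> : \tr (b^T *m b) =
    \tr (b^T *m T^T *m (T *m b)) + \tr (b^T *m Y^T *m (Y *m b)).
  rewrite -{1}(mulmx1 b^T) -TY mulmxDr mulmxDl linearD /=.
  by rewrite !mulmxA.
rewrite !mulmxA; lra.
Qed.

(** * Four-cycle-free matrices and overlaps of columns *)

Lemma four_cycle_freeP {m n} {M : 'M[bool]_(m, n)} {i i' j j'} :
  four_cycle_free M -> M i j -> M i j' -> M i' j -> M i' j' ->
  j != j' -> i = i'.
Proof.
move=> fM Mij Mij' Mi'j Mi'j' jj'; apply/eqP/negPn/negP => ii'.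
apply: (fM [set i; i']%SET [set j; j']%SET); rewrite ?cards2 ?ii' ?jj' //.
by move=> x y /set2P[] -> /set2P[] ->.
Qed.

Lemma four_cycle_free_tr {m n} (M : 'M[bool]_(m, n)) :
  four_cycle_free M -> four_cycle_free M^T.
Proof.
move=> fM A B cA cB AB; apply: (fM B A) => // i j iB jA.
by have := AB j i jA iB; rewrite mxE.
Qed.

Lemma four_cycle_free_mxsub {m n m' n'} (M : 'M[bool]_(m, n))
    (f : 'I_m' -> 'I_m) (g : 'I_n' -> 'I_n) :
  injective f -> injective g -> four_cycle_free M ->
  four_cycle_free (mxsub f g M).
Proof.
move=> fi gi fM A B cA cB AB; apply: (fM (f @: A) (g @: B)).
- by rewrite card_imset.
- by rewrite card_imset.
by move=> _ _ /imsetP[i iA ->] /imsetP[j jB ->]; have := AB i j iA jB; rewrite mxE.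
Qed.

(** Two distinct columns share a one in at most one row, so the sum has at most one nonzero term. *)
Lemma codegree_sqr {R : realType} {m n} (M : 'M[bool]_(m, n)) (p : 'I_m -> R) j j' :
  four_cycle_free M -> j != j' ->
  (\sum_i p i * (M i j)%:R * (M i j')%:R) ^+ 2 =
  \sum_i p i ^+ 2 * (M i j)%:R * (M i j')%:R.
Proof.
move=> fM jj'; rewrite expr2 mulr_suml; apply: eq_bigr => i _.
rewrite mulr_sumr (bigD1 i) //= big1 => [|i' /eqP ii'].
  by case: (M i j) (M i j') => -[]; rewrite !(mulr0, mul0r, mulr1, addr0) ?expr2.
have [Mij|_] := boolP (M i j); last by rewrite mulr0 !mul0r.
have [Mij'|_] := boolP (M i j'); last by rewrite mulr0 mul0r.
have [Mi'j|_] := boolP (M i' j); last by rewrite mulr0 mul0r mulr0.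
have [Mi'j'|_] := boolP (M i' j'); last by rewrite !mulr0.
by case: ii'; exact: (four_cycle_freeP fM Mi'j Mi'j' Mij Mij').
Qed.

(* The row weights p i make p i * deg i = 1, so that sum_j s j = m, whereas the
   contribution of the four-cycle-free overlaps is only sum_j 1 = n. *)
Lemma weighted_gram_sqr_le {R : realType} {m n} (M : 'M[bool]_(m, n))
    (p : 'I_m -> R) (s : 'I_n -> R) :
  four_cycle_free M -> (forall i, 0 <= p i) ->
  (forall i, p i * \sum_j (M i j)%:R = 1) ->
  (forall j, 0 < s j) -> (forall j, s j = \sum_i p i * (M i j)%:R) ->
  \sum_j \sum_j' (\sum_i p i * (M i j)%:R * (M i j')%:R) ^+ 2 / s j'
    <= m%:R + n%:R.
Proof.
move=> fM p0 pe s0 sE.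
have bb (b : bool) : b%:R * b%:R = b%:R :> R by case: b; rewrite ?mulr1 ?mulr0.
pose c j j' := \sum_i p i ^+ 2 * (M i j)%:R * (M i j')%:R.
(* The diagonal term is [s j ^ 2 / s j = s j]. The nonnegative [c j j / s j] is added so that the
   inner sum runs over all [j'] and can be evaluated exactly. *)
apply: (@le_trans _ _ (\sum_j (s j + \sum_j' c j j' / s j'))).
  apply: ler_sum => j _; have c0 j' : 0 <= c j j' / s j'.
    by rewrite divr_ge0 ?(ltW (s0 _)) // sumr_ge0 // => i _; rewrite !mulr_ge0 ?sqr_ge0.
  rewrite (bigD1 j) //= [X in _ <= _ + X](bigD1 j) //= addrA lerD //.
    rewrite (_ : \sum_i _ = s j); last first.
      by rewrite sE; apply: eq_bigr => i _; rewrite -mulrA bb.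
    by rewrite expr2 mulfK ?gt_eqF // lerDl.
  apply: ler_sum => j' j'j; rewrite codegree_sqr //.
  by rewrite eq_sym.
rewrite big_split /= lerD //.
  under eq_bigr do rewrite sE.
  rewrite exchange_big /= (eq_bigr (fun=> 1)) => [|i _].
    by rewrite sumr_const card_ord.
  by rewrite -mulr_sumr pe.
(* Summing over [j] first, [p i * deg i = 1] turns [p i ^ 2] into [p i], so the [c j j'] add up to
   [s j']. *)
rewrite exchange_big /= (eq_bigr (fun=> 1)) => [|j' _].
  by rewrite sumr_const card_ord.
rewrite -mulr_suml /c exchange_big /=.
rewrite (_ : \sum_i _ = s j') ?divff ?gt_eqF // sE; apply: eq_bigr => i _.
by rewrite -mulr_suml -mulr_sumr expr2 -(mulrA (p i)) pe mulr1.
Qed.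

(** * Lower bound under a degree condition *)

(** The rows, the more numerous side, carry the degree [d]; columns are nonempty so that the weights
    [s j] are positive and can be divided by. *)
Lemma sqrt_min_degree_le {R : realType} {m n k} (M : 'M[bool]_(m, n))
    (U : 'M[R]_(m, k)) (V : 'M[R]_(n, k)) (d g : R) :
  four_cycle_free M -> U *m V^T = bool_mx M -> (0 < m)%N -> (n <= m)%N ->
  0 < d -> (forall i, d <= \sum_j (M i j)%:R) -> (forall j, exists i, M i j) ->
  (forall i, (U *m U^T) i i <= g) -> (forall j, (V *m V^T) j j <= g) ->
  Num.sqrt d <= 2 * g.
Proof.
move=> fM UV m0 nm d0 de Mc Ug Vg.
have g0 : 0 <= g.
  apply: le_trans (Ug (Ordinal m0)).
  by rewrite -{1}(trmxK U) gram_diag_ge0.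
pose e i := \sum_j (M i j)%:R : R.
have e0 i : 0 < e i by exact: lt_le_trans (de i).
pose p i := (e i)^-1.
have p0 i : 0 < p i by rewrite invr_gt0.
have pe i : p i * e i = 1 by rewrite mulVf ?gt_eqF.
pose s j := \sum_i p i * (M i j)%:R.
have s0 j : 0 < s j.
  have [i Mij] := Mc j; rewrite /s (bigD1 i) //= Mij mulr1 ltr_pwDl //.
  by apply: sumr_ge0 => i' _; rewrite mulr_ge0 // ltW.
have sm : \sum_j s j = m%:R.
  rewrite exchange_big /= (eq_bigr (fun=> 1)) => [|i _].
    by rewrite sumr_const card_ord.
  by rewrite -mulr_sumr pe.
have rs j : Num.sqrt (s j) * Num.sqrt (s j) = s j.
  by rewrite -expr2 sqr_sqrtr // ltW.
have rs0 j : Num.sqrt (s j) != 0 by rewrite gt_eqF // sqrtr_gt0.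
have rp i : Num.sqrt (p i) * Num.sqrt (p i) = p i.
  by rewrite -expr2 sqr_sqrtr // ltW.
pose X : 'M[R]_(m, n) :=
  \matrix_(i, j) (Num.sqrt (p i) * (M i j)%:R / Num.sqrt (s j)).
pose a : 'M[R]_(m, k) := \matrix_(i, l) (Num.sqrt (p i) * U i l).
pose b : 'M[R]_(n, k) := \matrix_(j, l) (Num.sqrt (s j) * V j l).
have [T [Y TY] XT] := truncated_polar X.
have GE j j' : (X^T *m X) j j' =
    (\sum_i p i * (M i j)%:R * (M i j')%:R) / (Num.sqrt (s j) * Num.sqrt (s j')).
  rewrite mxE mulr_suml; apply: eq_bigr => i _; rewrite !mxE -[in RHS]rp.
  by field; rewrite !rs0.
have G1 j : (X^T *m X) j j = 1.
  rewrite GE rs (_ : \sum_i _ = s j) ?divff ?gt_eqF //.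
  by apply: eq_bigr => i _; case: (M i j); rewrite ?mulr1 ?mulr0.
have G2 : \sum_j s j * (X^T *m X *m (X^T *m X)) j j <= m%:R + n%:R.
  apply: le_trans (weighted_gram_sqr_le M p s fM (fun i => ltW (p0 i)) pe s0 (fun=> erefl)).
  apply: ler_sum => j _; rewrite mxE mulr_sumr; apply: ler_sum => j' _.
  rewrite !GE; under [X in _ * (_ * (X / _))]eq_bigr do rewrite mulrAC.
  move: (rs j) (rs j') (rs0 j) (rs0 j').
  move: (Num.sqrt (s j)) (Num.sqrt (s j')) => u v <- <- u0 v0.
  by rewrite le_eqVlt; apply/orP; left; apply/eqP; field; rewrite ?u0 ?v0.
(* Since [U V^T] is the matrix itself, the [(j, i)] entry of [b a^T] is [s j * X i j]. *)
have LE : \tr (a^T *m T *m b) = \sum_j s j * (X^T *m T) j j.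
  rewrite mxtrace_mulC mulmxA; apply: eq_bigr => j _.
  rewrite mxE [in RHS]mxE mulr_sumr; apply: eq_bigr => i _; rewrite mulrA.
  congr (_ * _); rewrite !mxE -[X in _ = X * _]rs.
  have -> : (M i j)%:R = (U *m V^T) i j by rewrite UV mxE.
  rewrite mxE (_ : \sum_l _ = Num.sqrt (s j) * Num.sqrt (p i) *
    \sum_l U i l * V^T l j); first by field; rewrite rs0.
  by rewrite mulr_sumr; apply: eq_bigr => l _; rewrite !mxE; ring.
(* As [n <= m], [3 m - (m + n) >= m]. *)
have L1 : m%:R <= 2 * \tr (a^T *m T *m b).
  rewrite LE mulr_sumr.
  apply: (@le_trans _ _ (\sum_j (3 * s j - s j * (X^T *m X *m (X^T *m X)) j j))).
    rewrite sumrB -mulr_sumr sm.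
    have : n%:R <= m%:R :> R by rewrite ler_nat.
    lra.
  apply: ler_sum => j _; have := XT j; rewrite G1 => /(ler_wpM2l (ltW (s0 j))).
  by rewrite mulrBr; lra.
have aa : \tr (a^T *m a) <= m%:R * g / d.
  rewrite gram_mxtraceE.
  apply: (@le_trans _ _ (\sum_(i < m) g / d)); last first.
    by rewrite sumr_const card_ord -mulrA mulr_natl.
  apply: ler_sum => i _.
  have -> : (a *m a^T) i i = p i * (U *m U^T) i i.
    rewrite !mxE mulr_sumr; apply: eq_bigr => l _; rewrite !mxE -[in RHS]rp; ring.
  rewrite mulrC; apply: ler_pM; rewrite ?(ltW (p0 i)) //.
    by rewrite -{1}(trmxK U) gram_diag_ge0.
  by rewrite /p lef_pV2 ?posrE ?e0 ?d0 // de.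
have bb : \tr (b^T *m b) <= m%:R * g.
  rewrite gram_mxtraceE -sm mulr_suml; apply: ler_sum => j _.
  have -> : (b *m b^T) j j = s j * (V *m V^T) j j.
    rewrite !mxE mulr_sumr; apply: eq_bigr => l _; rewrite !mxE -[in RHS]rs; ring.
  by rewrite ler_wpM2l // ltW.
(* Scaling [a] by [sqrt d] balances the two traces: both are then at most [m * g]. *)
have := contraction_form_le T Y (Num.sqrt d *: a) b TY.
have -> : (Num.sqrt d *: a)^T = Num.sqrt d *: a^T by rewrite linearZ.
rewrite -!scalemxAl -scalemxAr scalerA !mxtraceZ -expr2 sqr_sqrtr ?(ltW d0) // => H.
have r0 : 0 <= Num.sqrt d := sqrtr_ge0 _.
have H1 := ler_wpM2l r0 L1.
have H2 := ler_wpM2l (ltW d0) aa.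
rewrite [leRHS]mulrC divfK ?gt_eqF // in H2.
have m0' : 0 < m%:R :> R by rewrite ltr0n.
have : m%:R * Num.sqrt d <= m%:R * (2 * g); last by rewrite (ler_pM2l m0').
lra.
Qed.

(** * Upper bound from a row-sparse plus column-sparse splitting *)

(** At [d = 0] the inverse [t^-1] is 0 by convention, so the factorization recovers [A + B] only
    when [B = 0]. *)
Lemma gamma2_add_le {R : realType} {m n} (A B : 'M[R]_(m, n)) (d : R) :
  0 <= d -> (d = 0 -> B = 0) ->
  (forall i, \sum_j A i j ^+ 2 <= d) -> (forall j, \sum_i B i j ^+ 2 <= d) ->
  gamma2 (A + B) <= 2 * Num.sqrt d.
Proof.
move=> d0 B0 Ad Bd; pose t := Num.sqrt d.
have tt : t * t = d by rewrite -expr2 sqr_sqrtr.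
have t0 : 0 <= t := sqrtr_ge0 _.
pose U := row_mx A t%:M; pose V := col_mx 1%:M (t^-1 *: B).
have UV : A + B = U *m V.
  rewrite mul_row_col mulmx1 mul_scalar_mx scalerA; congr (_ + _).
  have [td|td] := eqVneq t 0; last by rewrite divff ?scale1r.
  by rewrite B0 ?scaler0 // -tt td mulr0.
apply: (@le_trans _ _ (row_norm U * col_norm V)).
  by apply: gamma2_le; exists (n + m)%N, U, V.
(* Rows of [U] have squared norm at most [d + t^2 = 2 d], columns of [V] at most [1 + 1]. *)
have -> : 2 * Num.sqrt d = Num.sqrt (2 * d) * Num.sqrt 2.
  rewrite -sqrtrM ?mulr_ge0 // mulrAC -expr2 sqrtrM ?sqr_ge0 //.
  by rewrite sqrtr_sqr ger0_norm.
rewrite col_normE; apply: ler_pM; rewrite ?row_norm_ge0 //.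
  apply/row_norm_le => [|i]; first exact: sqrtr_ge0.
  rewrite sqr_sqrtr ?mulr_ge0 // tr_row_mx mul_row_col mxE tr_scalar_mx.
  rewrite -scalar_mxM tt mxE [X in _ + X]mxE eqxx mulr1n.
  have := Ad i; rewrite (eq_bigr (fun j => A i j * A^T j i)).
    lra.
  by move=> j _; rewrite mxE expr2.
apply/row_norm_le => [|j]; first exact: sqrtr_ge0.
rewrite sqr_sqrtr // trmxK tr_col_mx mul_row_col trmx1 mulmx1.
rewrite mxE [X in X + _]mxE eqxx mulr1n.
have -> : ((t^-1 *: B)^T *m (t^-1 *: B)) j j = t^-1 ^+ 2 * \sum_i B i j ^+ 2.
  by rewrite mxE mulr_sumr; apply: eq_bigr => i _; rewrite !mxE; ring.
have : t^-1 ^+ 2 * \sum_i B i j ^+ 2 <= 1; last by lra.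
apply: (le_trans (ler_wpM2l (sqr_ge0 _) (Bd j))).
have [td|td] := eqVneq t 0; first by rewrite -tt td mulr0 mulr0.
by rewrite -tt expr2 (_ : _ * _ = 1) //; field.
Qed.

Lemma degenerate_split {m n} (M : 'M[bool]_(m, n)) (d : nat) :
  degenerate M d ->
  exists r : 'I_m -> 'I_n -> bool,
    (forall i, #|[set j | M i j && r i j]%SET| <= d)%N /\
    (forall j, #|[set i | M i j && ~~ r i j]%SET| <= d)%N.
Proof.
move=> degM.
(* Generalized to submatrices so that induction can delete one row or column; [N] bounds how many
   are left. *)
suff H N : forall (A : {set 'I_m}) (B : {set 'I_n}), (#|A| + #|B| <= N)%N ->
    exists r : 'I_m -> 'I_n -> bool,
      (forall i, i \in A -> #|[set j in B | M i j && r i j]%SET| <= d)%N /\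
      (forall j, j \in B -> #|[set i in A | M i j && ~~ r i j]%SET| <= d)%N.
  have [r [rA rB]] := H _ finset.setT finset.setT (leqnn _).
  exists r; split=> [i|j].
    by apply: leq_trans (rA i (finset.in_setT _)); apply/subset_leq_card/fintype.subsetP => j; rewrite !inE.
  by apply: leq_trans (rB j (finset.in_setT _)); apply/subset_leq_card/fintype.subsetP => i; rewrite !inE.
elim: N => [|N IH] A B.
  rewrite leqn0 addn_eq0 !cards_eq0 => /andP[/eqP -> /eqP ->].
  by exists (fun _ _ => true); split=> i; rewrite inE.
move=> AB; have [A0|A0] := eqVneq A finset.set0.
  exists (fun _ _ => true); rewrite A0; split=> [i|j _]; first by rewrite inE.
  by rewrite eq_card0 // => i; rewrite !inE.
have [B0|B0] := eqVneq B finset.set0.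
  exists (fun _ _ => true); rewrite B0; split=> [i _|j]; last by rewrite inE.
  by rewrite eq_card0 // => j; rewrite !inE.
move/forallP/(_ A)/forallP/(_ B): degM; rewrite A0 B0 /=.
case/orP => /existsP[x /andP[xS xd]].
  have [|r [rA rB]] := IH (A :\ x)%SET B.
    by move: AB; rewrite (cardsD1 x A) xS addnC addnS ltnS addnC.
  (* All ones of the deleted row [x] go to the row part, so no column count grows. *)
  exists (fun i j => (i == x) || r i j); split=> [i iA|j jB].
    have [->|ix] := eqVneq i x.
      apply: leq_trans xd; apply/subset_leq_card/fintype.subsetP => j; rewrite !inE.
      by case/and3P=> -> ->.
    by apply: leq_trans (rA i _); rewrite ?inE ?ix.
  apply: leq_trans (rB j jB); apply/subset_leq_card/fintype.subsetP => i.
  by rewrite !inE negb_or => /and4P[-> -> -> ->].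
have [|r [rA rB]] := IH A (B :\ x)%SET.
  by move: AB; rewrite (cardsD1 x B) xS addnS ltnS.
(* Dually, all ones of the deleted column [x] go to the column part. *)
exists (fun i j => (j != x) && r i j); split=> [i iA|j jB].
  apply: leq_trans (rA i iA); apply/subset_leq_card/fintype.subsetP => j.
  by rewrite !inE => /and4P[-> -> -> ->].
have [->|jx] := eqVneq j x.
  apply: leq_trans xd; apply/subset_leq_card/fintype.subsetP => i; rewrite !inE.
  by case/and3P=> -> ->.
by apply: leq_trans (rB j _); rewrite ?inE ?jx.
Qed.

Lemma sumr_bool_card {R : realType} {n} (P : pred 'I_n) :
  \sum_j (P j)%:R = #|[set j | P j]%SET|%:R :> R.
Proof.
rewrite -sum1_card natr_sum big_mkcond [RHS]big_mkcond /=.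
by apply: eq_bigr => j _; rewrite inE; case: (P j).
Qed.

Lemma gamma2_degenerate_le {R : realType} {m n} (M : 'M[bool]_(m, n)) (d : nat) :
  degenerate M d -> gamma2 (bool_mx M : 'M[R]_(m, n)) <= 2 * Num.sqrt d%:R.
Proof.
move=> /degenerate_split[r [rA rB]].
pose A : 'M[R]_(m, n) := \matrix_(i, j) (M i j && r i j)%:R.
pose B : 'M[R]_(m, n) := \matrix_(i, j) (M i j && ~~ r i j)%:R.
have sqr_bool (b : bool) : b%:R ^+ 2 = b%:R :> R.
  by case: b; rewrite ?expr1n ?expr0n.
have -> : bool_mx M = A + B.
  apply/matrixP => i j; rewrite !mxE.
  by case: (M i j) (r i j) => -[]; rewrite ?addr0 ?add0r.
apply: gamma2_add_le => [//|/eqP|i|j].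
- rewrite pnatr_eq0 => /eqP d0; apply/matrixP => i j; rewrite !mxE.
  have := rB j; rewrite d0 leqn0 cards_eq0 => /eqP/setP/(_ i).
  by rewrite !inE => ->.
- under eq_bigr do rewrite mxE sqr_bool.
  by rewrite (sumr_bool_card (fun j => M i j && r i j)) ler_nat.
- under eq_bigr do rewrite mxE sqr_bool.
  by rewrite (sumr_bool_card (fun i => M i j && ~~ r i j)) ler_nat.
Qed.

(** * Lower bound for general matrices *)

Lemma min_degree_submatrix {m n} (M : 'M[bool]_(m, n)) :
  (0 < degeneracy M)%N ->
  exists (A : {set 'I_m}) (B : {set 'I_n}),
    [/\ A != finset.set0, B != finset.set0,
     forall i, i \in A -> (degeneracy M <= #|[set j in B | M i j]%SET|)%N &
     forall j, j \in B -> (degeneracy M <= #|[set i in A | M i j]%SET|)%N].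
Proof.
rewrite /degeneracy; case: ex_minnP => d _ dmin d0.
(* By minimality of [d], some submatrix has more than [d - 1] ones in every row and column. *)
have : ~~ degenerate M d.-1.
  by apply/negP => /dmin; rewrite leqNgt prednK // leqnn.
rewrite /degenerate negb_forall => /existsP[A].
rewrite negb_forall => /existsP[B].
rewrite negb_imply negb_or => /andP[/andP[A0 B0] /andP[nA nB]].
exists A, B; split=> // [i iA|j jB]; rewrite -(prednK d0) ltnNge; apply/negP => h.
  by case/existsP: nA; exists i; rewrite iA.
by case/existsP: nB; exists j; rewrite jB.
Qed.

(** Transfers degree counts to the submatrix reindexed by ordinals. *)
Lemma card_enum_val_set {T : finType} (A : {set T}) (P : pred T) :
  #|[set x in A | P x]%SET| = #|[set y : 'I_#|A| | P (enum_val y)]%SET|.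
Proof.
rewrite -(card_imset _ enum_val_inj); apply: eq_card => x.
apply/idP/imsetP => [|[y]]; rewrite !inE.
  by case/andP=> xA Px; exists (enum_rank_in xA x); rewrite ?inE enum_rankK_in.
by move=> Py ->; rewrite enum_valP.
Qed.

Lemma sqrt_degeneracy_le {R : realType} {m n} (M : 'M[bool]_(m, n)) :
  four_cycle_free M ->
  Num.sqrt (degeneracy M)%:R <= 2 * gamma2 (bool_mx M : 'M[R]_(m, n)).
Proof.
move=> fM; have [k [U [V [UV gE]]]] := gamma2_in (bool_mx M : 'M[R]_(m, n)).
(* All rows of [W], in both blocks, have squared norm at most [gamma2], a bound that passes to
   submatrices. *)
have [W WUV Wg] := factor_norms_balanced U V.
set g := gamma2 _ in gE *; rewrite -gE in Wg; rewrite -UV in WUV.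
have g0 : 0 <= g by exact: le_trans (sqr_ge0 _) Wg.
have [d0|d0] := posnP (degeneracy M); first by rewrite d0 sqrtr0 mulr_ge0.
have [A [B [A0 B0 dA dB]]] := min_degree_submatrix M d0.
pose f := @enum_val _ (mem A); pose h := @enum_val _ (mem B).
pose N := mxsub f h M.
have fN : four_cycle_free N.
  by apply: four_cycle_free_mxsub => //; exact: enum_val_inj.
pose U' := rowsub f (usubmx W); pose V' := rowsub h (dsubmx W).
have NUV : U' *m V'^T = bool_mx N.
  apply/matrixP => i j; rewrite !mxE.
  have := congr1 (fun Z : 'M[R]_(m, n) => Z (f i) (h j)) WUV.
  by rewrite !mxE => <-; apply: eq_bigr => l _; rewrite !mxE ?mulr1 ?lexx.
have Wd i : (W *m W^T) i i <= g.
  by apply: le_trans Wg; move: i; apply/(row_norm_le W (row_norm_ge0 W)); exact: lexx.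
have Ug i : (U' *m U'^T) i i <= g.
  apply: le_trans (Wd (lshift n (f i))).
  by rewrite !mxE ler_sum // => l _; rewrite !mxE ?mulr1 ?lexx.
have Vg j : (V' *m V'^T) j j <= g.
  apply: le_trans (Wd (rshift m (h j))).
  by rewrite !mxE ler_sum // => l _; rewrite !mxE ?mulr1 ?lexx.
have d0' : 0 < (degeneracy M)%:R :> R by rewrite ltr0n.
have rowN i : (degeneracy M <= #|[set j | N i j]%SET|)%N.
  rewrite (leq_trans (dA _ (enum_valP i))) // card_enum_val_set subset_leq_card //.
  by apply/fintype.subsetP => j; rewrite !inE mxE.
have colN j : (degeneracy M <= #|[set i | N i j]%SET|)%N.
  rewrite (leq_trans (dB _ (enum_valP j))) //.
  rewrite (card_enum_val_set A (fun i => M i (enum_val j))) subset_leq_card //.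
  by apply/fintype.subsetP => i; rewrite !inE mxE.
(* Transposing if necessary makes the rows at least as numerous as the columns. *)
have [AB|/ltnW AB] := leqP #|B| #|A|.
  apply: (sqrt_min_degree_le N U' V' _ _ fN NUV) => //.
  - by rewrite card_gt0.
  - by move=> i; rewrite (sumr_bool_card (N i)) ler_nat.
  - move=> j; have /card_gt0P[i] := leq_trans d0 (colN j).
    by rewrite inE; exists i.
apply: (sqrt_min_degree_le N^T V' U' _ _ (four_cycle_free_tr _ fN)) => //.
- by rewrite -[V']trmxK -trmx_mul NUV map_trmx.
- by rewrite card_gt0.
- move=> j; rewrite (sumr_bool_card (N^T j)) ler_nat (leq_trans (colN j)) //.
  by rewrite subset_leq_card //; apply/fintype.subsetP => i; rewrite !inE [N^T _ _]mxE.
- move=> i; have /card_gt0P[j] := leq_trans d0 (rowN i).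
  by rewrite inE; exists j; rewrite [N^T _ _]mxE.
Qed.

Theorem theorem1p5 (R : realType) :
  exists c C : R, [/\ 0 < c, 0 < C &
    forall (m n : nat) (M : 'M[bool]_(m, n)), four_cycle_free M ->
      c * Num.sqrt (degeneracy M)%:R <= gamma2 (bool_mx M)
        <= C * Num.sqrt (degeneracy M)%:R].
Proof.
exists 2^-1, 2; split=> // m n M fM.
apply/andP; split; first by rewrite ler_pdivrMl // sqrt_degeneracy_le.
by apply: gamma2_degenerate_le; rewrite /degeneracy; case: ex_minnP.
Qed.
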